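(* Let $\Theta=(J_3,J_5,\alpha,\beta)$ be a Jacobi-type pencil, where $J_3$ has entries $a_k>0$, $b_k\in\mathbb{R}$ and $J_5$ has entries $\alpha_k,\beta_k\in\mathbb{R}$, $\gamma_k>0$ ($k\in\mathbb{Z}_+$). Let $\{p_n(\lambda)\}_{n=0}^\infty$ be the associated polynomials of $\Theta$, $\{q_n(\lambda)\}_{n=0}^\infty$ the polynomials of the second kind for $\Theta$, $\{u_n(\lambda)\}_{n=0}^\infty$ the shifted polynomials for $\Theta$, and $\{w_n(\lambda)\}_{n=0}^\infty$ the double-shifted polynomials for $\Theta$. Then for every $\lambda\in\mathbb{C}$ the four complex sequences $\{p_n(\lambda)\}_{n\ge 0}$, $\{q_n(\lambda)\}_{n\ge 0}$, $\{u_n(\lambda)\}_{n\ge 0}$, $\{w_n(\lambda)\}_{n\ge 0}$ form a basic set of solutions (that is, a basis of the complex vector space of all solutions $\{y_k\}_{k=0}^\infty$) of the fourth order linear difference equation $$\gamma_{n-2}y_{n-2}+(\beta_{n-1}-\lambda a_{n-1})y_{n-1}+(\alpha_n-\lambda b_n)y_n+(\beta_n-\lambda a_n)y_{n+1}+\gamma_n y_{n+2}=0,\qquad n=2,3,\ldots$$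
   Context: $\mathbb{Z}_+$ denotes the non-negative integers and $\mathbb{P}$ the set of all polynomials with complex coefficients. A Jacobi-type pencil is a tuple $\Theta=(J_3,J_5,\alpha,\beta)$, where $\alpha>0$, $\beta\in\mathbb{R}$, $J_3$ is a semi-infinite real symmetric tridiagonal (Jacobi) matrix, rows and columns indexed by $\mathbb{Z}_+$, with diagonal entries $b_0,b_1,\ldots\in\mathbb{R}$ and entries $(J_3)_{k,k+1}=(J_3)_{k+1,k}=a_k>0$, and $J_5$ is a semi-infinite real symmetric five-diagonal matrix with diagonal entries $\alpha_k\in\mathbb{R}$, $(J_5)_{k,k+1}=(J_5)_{k+1,k}=\beta_k\in\mathbb{R}$, $(J_5)_{k,k+2}=(J_5)_{k+2,k}=\gamma_k>0$, $k\in\mathbb{Z}_+$. Associated polynomials of $\Theta$: the unique system $\{p_n(\lambda)\}_{n=0}^\infty$ with $p_0(\lambda)=1$, $p_1(\lambda)=\alpha\lambda+\beta$ and $(J_5-\lambda J_3)(p_0(\lambda),p_1(\lambda),\ldots)^T=0$, i.e. $$\gamma_{n-2}p_{n-2}(\lambda)+(\beta_{n-1}-\lambda a_{n-1})p_{n-1}(\lambda)+(\alpha_n-\lambda b_n)p_n(\lambda)+(\beta_n-\lambda a_n)p_{n+1}(\lambda)+\gamma_np_{n+2}(\lambda)=0,\quad n\in\mathbb{Z}_+,$$ where $p_{-2}=p_{-1}=0$ and $\gamma_{-2}=\gamma_{-1}=a_{-1}=\beta_{-1}=0$. Each $p_n$ is a real polynomial of degree $n$ with positive leading coefficient. Spectral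 function of $\Theta$: the sesquilinear functional $S(u,v)$, $u,v\in\mathbb{P}$ (linear in $u$, conjugate-linear in $v$), with $S(p_n,p_m)=\delta_{n,m}$ for all $n,m\in\mathbb{Z}_+$. Polynomials of the second kind: $q_n(\lambda)=S_t\left(\frac{p_n(\lambda)-p_n(t)}{\lambda-t},1\right)$, $n\in\mathbb{Z}_+$, where the subscript $t$ means that the arguments of $S$ are regarded as polynomials in $t$. Shifted pencil: for a Jacobi-type pencil $\Theta=(J_3,J_5,\alpha,\beta)$ with $(J_3)_{k,k}=b_k$, $(J_3)_{k,k+1}=(J_3)_{k+1,k}=a_k$, $(J_5)_{k,k}=\alpha_k$, $(J_5)_{k,k+1}=(J_5)_{k+1,k}=\beta_k$, $(J_5)_{k,k+2}=(J_5)_{k+2,k}=\gamma_k$ ($k\in\mathbb{Z}_+$), let $J_3',J_5'$ be obtained from $J_3,J_5$ by deleting the first row and the first column; the shifted pencil is the Jacobi-type pencil $\Theta'=\left(J_3',J_5',\frac{a_0}{\gamma_0},-\frac{\beta_0}{\gamma_0}\right)$. Shifted polynomials for $\Theta$: $u_0(\lambda)=0$ and $u_k(\lambda)=f_{k-1}(\lambda)$ for $k\ge1$, where $\{f_n\}_{n\ge0}$ are the associated polynomials of $\Theta'$. Double-shifted polynomials for $\Theta$: $w_0(\lambda)=w_1(\lambda)=0$ and $w_k(\lambda)=\widetilde f_{k-2}(\lambda)$ for $k\ge2$, where $\{\widetilde f_n\}_{n\ge0}$ are the associated polynomials of $(\Theta')'=\left((J_3')',(J_5')',\frac{a_1}{\gamma_1},-\frac{\beta_1}{\gamma_1}\right)$.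 *)

(* Defs.v *)
From HB Require Import structures.
From mathcomp Require Import all_boot all_order all_algebra.
From mathcomp Require Import boolp classical_sets functions reals.
From mathcomp.real_closed Require Import complex.

Set Implicit Arguments.
Unset Strict Implicit.
Unset Printing Implicit Defensive.

Import Order.TTheory GRing.Theory Num.Theory.
Local Open Scope ring_scope.
Local Open Scope complex_scope.

(* A family v_0, ..., v_(n-1) is a basis of the subspace W; unlike basis_of of
   vector.v, the ambient space V may be infinite-dimensional. *)
Definition basis_of_subspace (K : fieldType) (V : lmodType K) (W : V -> Prop)
    (n : nat) (v : n.-tuple V) : Prop :=
  [/\ forall i : 'I_n, W (tnth v i),
      forall c : 'I_n -> K,
        \sum_(i < n) c i *: tnth v i = 0 -> forall i, c i = 0
    & forall y, W y -> exists c : 'I_n -> K, y = \sum_(i < n) c i *: tnth v i].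

Record jacobi_type_pencil (R : realType) := JacobiTypePencil {
  J3 : nat -> nat -> R;
  J5 : nat -> nat -> R;
  jp_alpha : R;
  jp_beta : R;
  jp_alpha_gt0 : 0 < jp_alpha;
  J3_sym : forall i j, J3 i j = J3 j i;
  J3_tridiag : forall i j, (i.+1 < j)%N -> J3 i j = 0;
  J3_gt0 : forall k, 0 < J3 k k.+1;
  J5_sym : forall i j, J5 i j = J5 j i;
  J5_fivediag : forall i j, (i.+2 < j)%N -> J5 i j = 0;
  J5_gt0 : forall k, 0 < J5 k k.+2
}.

Section Pencil.
Variable R : realType.
Local Notation C := R[i].
Implicit Type T : jacobi_type_pencil R.

Definition ja T (k : nat) : R := J3 T k k.+1.
Definition jb T (k : nat) : R := J3 T k k.
Definition jalpha T (k : nat) : R := J5 T k k.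
Definition jbeta T (k : nat) : R := J5 T k k.+1.
Definition jgamma T (k : nat) : R := J5 T k k.+2.

(* Entry n of (J5 - lam J3) y, with the convention that entries of y and
   coefficients with a negative index vanish. *)
Definition pencil_row T (lam : C) (y : nat -> C) (n : nat) : C :=
  (if n is m.+2 then (jgamma T m)%:C * y m else 0)
  + (if n is m.+1 then ((jbeta T m)%:C - lam * (ja T m)%:C) * y m else 0)
  + ((jalpha T n)%:C - lam * (jb T n)%:C) * y n
  + ((jbeta T n)%:C - lam * (ja T n)%:C) * y n.+1
  + (jgamma T n)%:C * y n.+2.

Definition associated_polynomials T (p : nat -> {poly C}) : Prop :=
  [/\ p 0%N = 1,
      p 1%N = (jp_alpha T)%:C *: 'X + ((jp_beta T)%:C)%:P
    & forall (lam : C) n, pencil_row T lam (fun k => (p k).[lam]) n = 0].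

Definition sesquilinear_functional :=
  {bilinear {poly C} -> {poly C} -> C | *%R & Num.conj \; *%R}.

Lemma sesquilinearZl (S : sesquilinear_functional) (a : C) (u v : {poly C}) :
  S (a *: u) v = a * S u v.
Proof. exact: linearZl_LR. Qed.

Lemma sesquilinearZr (S : sesquilinear_functional) (a : C) (u v : {poly C}) :
  S u (a *: v) = a^* * S u v.
Proof. exact: linearZr_LR. Qed.

Definition spectral_function T (S : sesquilinear_functional) : Prop :=
  forall p, associated_polynomials T p ->
  forall n m, S (p n) (p m) = (n == m)%:R.

(* The division is exact, and is carried out in the variable t = 'X. *)
Definition second_kind (S : sesquilinear_functional) (p : nat -> {poly C})
    (n : nat) (lam : C) : C :=
  S ((((p n).[lam])%:P - p n) %/ (lam%:P - 'X)) 1.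

Lemma shifted_alpha_gt0 T : 0 < ja T 0%N / jgamma T 0%N.
Proof. by rewrite divr_gt0 ?J3_gt0 ?J5_gt0. Qed.

Definition shifted_pencil T : jacobi_type_pencil R :=
  @JacobiTypePencil R (fun i j => J3 T i.+1 j.+1) (fun i j => J5 T i.+1 j.+1)
    (ja T 0%N / jgamma T 0%N) (- (jbeta T 0%N / jgamma T 0%N)) (shifted_alpha_gt0 T)
    (fun i j => J3_sym T i.+1 j.+1)
    (fun i j => J3_tridiag T (i := i.+1) (j := j.+1))
    (fun k => J3_gt0 T k.+1)
    (fun i j => J5_sym T i.+1 j.+1)
    (fun i j => J5_fivediag T (i := i.+1) (j := j.+1))
    (fun k => J5_gt0 T k.+1).

Definition shifted_polynomials T (u : nat -> {poly C}) : Prop :=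
  u 0%N = 0 /\
  associated_polynomials (shifted_pencil T) (fun n => u n.+1).

Definition double_shifted_polynomials T (w : nat -> {poly C}) : Prop :=
  [/\ w 0%N = 0, w 1%N = 0
    & associated_polynomials (shifted_pencil (shifted_pencil T))
        (fun n => w n.+2)].

Definition difference_equation T (lam : C) (y : nat -> C) : Prop :=
  forall n, (2 <= n)%N -> pencil_row T lam y n = 0.

(* Existence and uniqueness of the associated polynomials and of the spectral
   function; in particular the two predicates above are never vacuous. *)

Lemma poly_eq_horner (p q : {poly C}) : (forall lam, p.[lam] = q.[lam]) -> p = q.
Proof.
move=> pq; apply/eqP; rewrite -subr_eq0; apply/eqP.
apply: (@roots_geq_poly_eq0 _ _ [seq i%:R | i <- iota 0 (size (p - q))]).
- by apply/allP=> x _; rewrite /root !hornerE pq subrr.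
- rewrite map_inj_uniq ?iota_uniq// => m n /eqP; rewrite eqr_nat; exact/eqP.
- by rewrite size_map size_iota.
Qed.

Let prow T (y : nat -> {poly C}) n : {poly C} :=
  (if n is m.+2 then (jgamma T m)%:C *: y m else 0)
  + (if n is m.+1 then ((jbeta T m)%:C%:P - (ja T m)%:C *: 'X) * y m else 0)
  + ((jalpha T n)%:C%:P - (jb T n)%:C *: 'X) * y n
  + ((jbeta T n)%:C%:P - (ja T n)%:C *: 'X) * y n.+1.

Let prowE T y n lam : pencil_row T lam (fun k => (y k).[lam]) n =
  (prow T y n + (jgamma T n)%:C *: y n.+2).[lam].
Proof.
by rewrite /pencil_row /prow; case: n => [|[|n]];
   rewrite !hornerE ?horner0 ?(mulrC lam).
Qed.

Let gamma_neq0 T n : (jgamma T n)%:C != 0 :> C.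
Proof. by rewrite eq_complex /= negb_and gt_eqF // J5_gt0. Qed.

Let prowP T p : (forall (lam : C) n,
    pencil_row T lam (fun k => (p k).[lam]) n = 0) <->
  (forall n, p n.+2 = - ((jgamma T n)%:C^-1 *: prow T p n)).
Proof.
split=> [H n|H lam n]; last first.
  by rewrite prowE H scalerN scalerA divff // scale1r subrr horner0.
have E : prow T p n + (jgamma T n)%:C *: p n.+2 = 0.
  by apply: poly_eq_horner => lam; rewrite -prowE H horner0.
by rewrite -scalerN (addr0_eq E) scalerA mulVf ?scale1r.
Qed.

Let eq_prow T y z n : (forall k, (k <= n.+1)%N -> y k = z k) ->
  prow T y n = prow T z n.
Proof.
move=> yz; rewrite /prow (yz n.+1) // (yz n) //.
by case: n yz => [|[|n]] yz //; rewrite ?(yz n.+1) ?(yz n) ?(yz 0%N) //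
  ltnW // ltnW // ltnW.
Qed.

Lemma associated_polynomials_exist T : exists p, associated_polynomials T p.
Proof.
pose p0 k : {poly C} := if k is 0%N then 1
  else (jp_alpha T)%:C *: 'X + ((jp_beta T)%:C)%:P.
pose step y n := - ((jgamma T n)%:C^-1 *: prow T y n).
pose aux := fix aux n := if n is m.+1 then
  fun k => if k == m.+2 then step (aux m) m else aux m k else p0.
have aux_stable m n k : (m <= n)%N -> (k <= m.+1)%N -> aux n k = aux m k.
  elim: n => [|n IHn]; first by rewrite leqn0 => /eqP->.
  rewrite leq_eqVlt ltnS => /predU1P[-> //|mn] km /=.
  by rewrite ifN ?IHn // neq_ltn ltnS (leq_trans km).
exists (fun n => aux n n); split=> //; apply/prowP => n.
rewrite [aux n.+2 n.+2](aux_stable n.+1) //= eqxx; congr (- (_ *: _)).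
apply: eq_prow => k; rewrite leq_eqVlt => /predU1P[->|].
  by rewrite [RHS](aux_stable n).
by rewrite ltnS => kn; apply: aux_stable.
Qed.

Lemma associated_polynomials_unique T p q :
  associated_polynomials T p -> associated_polynomials T q -> p =1 q.
Proof.
move=> [p0 p1 /prowP pE] [q0 q1 /prowP qE] n.
suff: forall k, (k <= n)%N -> p k = q k by exact.
elim: n => [|n IHn] k; first by rewrite leqn0 => /eqP->; rewrite p0.
rewrite leq_eqVlt => /predU1P[->|]; last exact: IHn.
case: n IHn => [|n] IHn; first by rewrite p1.
by rewrite pE qE (eq_prow T IHn).
Qed.

Lemma size_associated T p n : associated_polynomials T p -> size (p n) = n.+1.
Proof.
move=> [p0 p1 /prowP pE].
have alpha_neq0 : (jp_alpha T)%:C != 0 :> C.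
  by rewrite eq_complex /= negb_and gt_eqF // jp_alpha_gt0.
have size_lin (a b : R) : (size (b%:C%:P - a%:C *: 'X : {poly C})%R <= 2)%N.
  rewrite (leq_trans (size_polyD _ _)) // geq_max size_polyN.
  rewrite (leq_trans (size_polyC_leq1 _)) //=.
  by rewrite (leq_trans (size_scale_leq _ _)) ?size_polyX.
have size_mul_lin (a b : R) (u : {poly C}) m : (size u <= m)%N ->
    (size ((b%:C%:P - a%:C *: 'X) * u)%R <= m.+1)%N.
  move=> um; rewrite (leq_trans (size_polyMleq _ _)) //.
  by rewrite -subn1 leq_subLR (leq_trans (leq_add (size_lin a b) um)).
suff: forall k, (k <= n)%N -> size (p k) = k.+1 by exact.
elim: n => [|n IHn] k; first by rewrite leqn0 => /eqP->; rewrite p0 size_poly1.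
rewrite leq_eqVlt => /predU1P[->|]; last exact: IHn.
case: n IHn => [|n] IHn.
  rewrite p1 size_polyDl size_scale ?size_polyX //.
  exact: leq_ltn_trans (size_polyC_leq1 _) _.
have a_neq0 : (ja T n)%:C != 0 :> C.
  by rewrite eq_complex /= negb_and gt_eqF // J3_gt0.
have size2 : size ((jbeta T n)%:C%:P - (ja T n)%:C *: 'X : {poly C}) = 2.
  rewrite addrC size_polyDl size_polyN size_scale ?size_polyX //.
  exact: leq_ltn_trans (size_polyC_leq1 _) _.
have size_top :
    size (((jbeta T n)%:C%:P - (ja T n)%:C *: 'X : {poly C}) * p n.+1) = n.+3.
  by rewrite size_mul -?size_poly_eq0 ?size2 ?IHn.
rewrite pE size_polyN size_scale ?invr_eq0 // /prow addrC size_polyDl size_top //.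
rewrite ltnS (leq_trans (size_polyD _ _)) // geq_max.
rewrite (leq_trans (size_polyD _ _)) ?geq_max ?size_mul_lin ?IHn // ?andbT.
apply/andP; split; case: n IHn {size_top size2 a_neq0} => [|n] IHn;
  rewrite ?size_poly0 // ?size_mul_lin ?IHn //; last by rewrite leqW ?size_mul_lin ?IHn.
case: n IHn => [|n] IHn; rewrite ?size_poly0 //.
by rewrite (leq_trans (size_scale_leq _ _)) // IHn // ltnW // ltnW.
Qed.

Section Spectral.
Variable p : nat -> {poly C}.
Hypothesis size_p : forall n, size (p n) = n.+1.
Implicit Types u v : {poly C}.

Let lead_neq0 n : (p n)`_n != 0.
Proof.
by have := lead_coef_eq0 (p n); rewrite lead_coefE -size_poly_eq0 size_p => ->.
Qed.

Let reduce N (u : {poly C}) := u - (u`_N / (p N)`_N) *: p N.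

Let size_reduce N u : (size u <= N.+1)%N -> (size (reduce N u) <= N)%N.
Proof.
move=> uN; apply/leq_sizeP => j; rewrite leq_eqVlt => /predU1P[<-|Nj].
  by rewrite !coefE divfK ?subrr.
by rewrite coefB coefZ (nth_default _ (leq_trans uN Nj)) (@nth_default _ _ (p N) j)
  ?size_p // mulr0 subr0.
Qed.

(* Coordinates of u with respect to p, as the coefficients of a polynomial. *)
Let coords := fix coords N (u : {poly C}) : {poly C} := if N is M.+1 then
  (u`_M / (p M)`_M) *: 'X^M + coords M (reduce M u) else 0.

Let coords_linear N : linear (coords N).
Proof.
elim: N => [|N IHN] a u v /=; first by rewrite scaler0 addr0.
have -> : reduce N (a *: u + v) = a *: reduce N u + reduce N v.
  by rewrite /reduce !coefE mulrDl -mulrA scalerDl scalerBr scalerA opprD addrACA.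
by rewrite IHN !coefE mulrDl -mulrA scalerDl scalerDr scalerA addrACA.
Qed.

Let coords_stable M N u : (size u <= M)%N -> (M <= N)%N -> coords N u = coords M u.
Proof.
move=> uM; elim: N => [|N IHN]; first by rewrite leqn0 => /eqP->.
rewrite leq_eqVlt => /predU1P[-> //|]; rewrite ltnS => MN /=.
by rewrite /reduce nth_default ?(leq_trans uM) // mul0r !scale0r subr0 add0r IHN.
Qed.

Let size_coords N u : (size (coords N u) <= N)%N.
Proof.
elim: N u => [|N IHN] u /=; first by rewrite size_poly0.
rewrite (leq_trans (size_polyD _ _)) // geq_max (leqW (IHN _)) andbT.
by rewrite (leq_trans (size_scale_leq _ _)) ?size_polyXn.
Qed.

Let crd u := coords (size u) u.

Let crdE N u : (size u <= N)%N -> crd u = coords N u.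
Proof. by move=> uN; rewrite (coords_stable _ uN). Qed.

Let crd_linear : linear crd.
Proof.
move=> a u v; pose N := maxn (size u) (size v).
have uN : (size u <= N)%N by rewrite leq_maxl.
have vN : (size v <= N)%N by rewrite leq_maxr.
rewrite (crdE uN) (crdE vN) -coords_linear; apply: crdE.
rewrite (leq_trans (size_polyD _ _)) // geq_max vN andbT.
exact: leq_trans (size_scale_leq _ _) uN.
Qed.

Let crd_p n : crd (p n) = 'X^n.
Proof.
rewrite /crd size_p /= divff // scale1r /reduce divff // scale1r subrr.
rewrite (coords_stable (M := 0)) ?size_poly0 //= addr0 //.
Qed.

Let dot (u v : {poly C}) : C := \sum_(i < size u) u`_i * (v`_i)^*.

Let dotE N u v : (size u <= N)%N -> dot u v = \sum_(i < N) u`_i * (v`_i)^*.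
Proof.
move=> uN; rewrite /dot -!(big_mkord xpredT (fun i => u`_i * (v`_i)^*)).
rewrite [RHS](@big_cat_nat _ _ _ (size u)) //= [X in _ + X]big1_seq ?addr0 // => i.
by rewrite mem_index_iota => /andP[_ /andP[ui _]]; rewrite nth_default ?mul0r.
Qed.

Let form (u v : {poly C}) : C := dot (crd u) (crd v).

Let form_bilinear : bilinear_for
  (GRing.Scale.Law.clone _ _ *%R _) (GRing.Scale.Law.clone _ _ (Num.conj \; *%R) _)
  form.
Proof.
split=> [v|u] a x y /=; rewrite /form crd_linear.
  set cx := crd x; set cy := crd y; pose N := maxn (size cx) (size cy).
  have xN : (size cx <= N)%N by rewrite leq_maxl.
  have yN : (size cy <= N)%N by rewrite leq_maxr.
  have xyN : (size (a *: cx + cy)%R <= N)%N.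
    rewrite (leq_trans (size_polyD _ _)) // geq_max yN andbT.
    exact: leq_trans (size_scale_leq _ _) xN.
  rewrite (dotE _ xN) (dotE _ yN) (dotE _ xyN) mulr_sumr -big_split.
  by apply: eq_bigr => i _; rewrite !coefE mulrDl mulrA.
rewrite /dot mulr_sumr -big_split; apply: eq_bigr => i _.
by rewrite !coefE rmorphD rmorphM mulrDr mulrCA.
Qed.

Lemma orthonormalizing_functional_exists :
  exists S : sesquilinear_functional, forall n m, S (p n) (p m) = (n == m)%:R.
Proof.
pose B := bilinear_isBilinear.Build _ _ _ _ _ _ form form_bilinear.
pose S : sesquilinear_functional := HB.pack form B.
exists S => n m; rewrite /S /= /form !crd_p /dot size_polyXn.
rewrite big_ord_recr big1 /= ?add0r => [|i _].
  by rewrite !coefXn eqxx mul1r rmorph_nat.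
by rewrite coefXn ltn_eqF ?mul0r.
Qed.

Lemma orthonormalizing_functional_unique (S S' : sesquilinear_functional) :
  (forall n m, S (p n) (p m) = S' (p n) (p m)) -> forall u v, S u v = S' u v.
Proof.
move=> SS'.
have reduceE N u : u = reduce N u + (u`_N / (p N)`_N) *: p N by rewrite subrK.
have S1 n v : S (p n) v = S' (p n) v.
  move: {2}(size v) (leqnn (size v)) => N; elim: N v => [|N IHN] v vN.
    by move: vN; rewrite leqn0 size_poly_eq0 => /eqP->; rewrite !linear0r.
  by rewrite (reduceE N v) (linearDr S) (linearDr S') IHN ?size_reduce // !sesquilinearZr SS'.
move=> u v; move: {2}(size u) (leqnn (size u)) => N; elim: N u => [|N IHN] u uN.
  by move: uN; rewrite leqn0 size_poly_eq0 => /eqP->; rewrite !linear0l.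
by rewrite (reduceE N u) (linearDl S) (linearDl S') IHN ?size_reduce // !sesquilinearZl S1.
Qed.
End Spectral.

Lemma spectral_function_exists T :
  exists S : sesquilinear_functional, spectral_function T S.
Proof.
have [p pT] := associated_polynomials_exist T.
have [S Sp] := orthonormalizing_functional_exists (fun n => size_associated n pT).
exists S => q qT n m.
by rewrite -!(associated_polynomials_unique pT qT).
Qed.

Lemma spectral_function_unique T (S S' : sesquilinear_functional) :
  spectral_function T S -> spectral_function T S' -> forall u v, S u v = S' u v.
Proof.
have [p pT] := associated_polynomials_exist T.
move=> ST S'T.
apply: (orthonormalizing_functional_unique (fun n => size_associated n pT)).
by move=> n m; rewrite (ST p) // (S'T p).
Qed.

End Pencil.

(* Main.v *)
(** Compare rows 0 and 1 of the pencil, which the equation leaves out. The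
    sequences p and u are annihilated by every row; w is annihilated by row 1
    and gives gamma_0 on row 0; and q gives b_0 and a_0 on rows 0 and 1. Together
    with the initial values y_0 and y_1, these rows determine a solution, and the
    matrix of the four sequences with respect to them is invertible. *)

Require Import Defs.
From mathcomp Require Import all_boot all_order all_algebra.
From mathcomp Require Import boolp classical_sets functions reals.
From mathcomp.real_closed Require Import complex.
From mathcomp Require Import ring.

Set Implicit Arguments.
Unset Strict Implicit.
Unset Printing Implicit Defensive.

Import Order.TTheory GRing.Theory Num.Theory.
Local Open Scope ring_scope.

Section PencilRow.
Variables (R : realType) (T : jacobi_type_pencil R).
Local Notation C := R[i].
Implicit Types (lam c : C) (y z : nat -> C) (n : nat).

Lemma ja_neq0 n : (ja T n)%:C%C != 0 :> C.
Proof. by rewrite eq_complex /= negb_and gt_eqF // J3_gt0. Qed.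

Lemma jgamma_neq0 n : (jgamma T n)%:C%C != 0 :> C.
Proof. by rewrite eq_complex /= negb_and gt_eqF // J5_gt0. Qed.

Lemma pencil_rowD lam y z n :
  pencil_row T lam (fun k => y k + z k) n =
  pencil_row T lam y n + pencil_row T lam z n.
Proof. by rewrite /pencil_row; case: n => [|[|n]]; ring. Qed.

Lemma pencil_rowZ lam c y n :
  pencil_row T lam (fun k => c * y k) n = c * pencil_row T lam y n.
Proof. by rewrite /pencil_row; case: n => [|[|n]]; ring. Qed.

(** As [jgamma T n] is nonzero, row [n] determines [y n.+2] from at most four preceding entries.
    Hence a sequence is fixed by its rows and its first two values. *)
Lemma pencil_row_eq0 lam y : y 0%N = 0 -> y 1%N = 0 ->
  (forall n, pencil_row T lam y n = 0) -> forall n, y n = 0.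
Proof.
move=> y0 y1 rowy n.
suff: forall k, (k <= n.+1)%N -> y k = 0 by apply.
elim: n => [[|[|k]]//|n IHn k].
rewrite leq_eqVlt => /predU1P[->|]; last exact: IHn.
apply: (mulfI (jgamma_neq0 n)); rewrite mulr0 -[RHS](rowy n) /pencil_row.
rewrite (IHn n) // (IHn n.+1) //; case: n IHn => [|[|n]] IHn; last 2 first.
- by rewrite (IHn 0%N) // !mulr0 !add0r.
- by rewrite (IHn n) ?(IHn n.+1) ?mulr0 ?add0r // ltnW // ltnW.
- by rewrite !mulr0 !add0r.
Qed.

(** Deleting the first row and column of both matrices removes only terms that multiply [y 0]. *)
Lemma pencil_row_shift lam y n : y 0%N = 0 ->
  pencil_row T lam y n.+1 =
  pencil_row (shifted_pencil T) lam (fun k => y k.+1) n.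
Proof.
by move=> y0; rewrite /pencil_row; case: n => [|[|n]]; rewrite ?y0 ?mulr0.
Qed.

End PencilRow.

(** Only row 0 is not a row of the shifted pencil. It vanishes by the choice of initial data:
    gamma_0 u_2 = lam a_0 - beta_0 cancels (beta_0 - lam a_0) u_1, where u_1 = 1. *)
Lemma shifted_pencil_row (R : realType) (T : jacobi_type_pencil R)
    (u : nat -> {poly R[i]}) (lam : R[i]) n : shifted_polynomials T u ->
  pencil_row T lam (fun k => (u k).[lam]) n = 0.
Proof.
move=> [u0 [u1 u2 rowu]]; case: n => [|n]; last first.
  by rewrite pencil_row_shift ?u0 ?horner0 // rowu.
rewrite /pencil_row u0 u1 u2 !hornerE /= rmorphN /= !fmorph_div.
by field; exact: jgamma_neq0.
Qed.

(** Without its first entry, [w] is a system of shifted polynomials for the shifted pencil, which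
    settles the rows from 1 on. Row 0 sees only w_2 = 1. *)
Lemma double_shifted_pencil_row (R : realType) (T : jacobi_type_pencil R)
    (w : nat -> {poly R[i]}) (lam : R[i]) n : double_shifted_polynomials T w ->
  pencil_row T lam (fun k => (w k).[lam]) n =
  if n is 0 then (jgamma T 0)%:C%C else 0.
Proof.
move=> [w0 w1 wT]; case: n => [|n]; last first.
  rewrite pencil_row_shift ?w0 ?horner0 //.
  exact: (@shifted_pencil_row _ (shifted_pencil T) (fun k => w k.+1)).
case: wT => w2 _ _.
by rewrite /pencil_row w0 w1 w2 !hornerE.
Qed.

Section SecondKind.
Variables (R : realType) (T : jacobi_type_pencil R).
Local Notation C := R[i].
Variables (S : sesquilinear_functional R) (p : nat -> {poly C}) (lam : C).
Hypotheses (pT : associated_polynomials T p) (ST : spectral_function T S).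

Let D n : {poly C} := (((p n).[lam])%:P - p n) %/ (lam%:P - 'X).

Let DE n : D n * (lam%:P - 'X) = ((p n).[lam])%:P - p n.
Proof.
(* The division is exact because the numerator vanishes at t = lam. *)
rewrite divpK // -[lam%:P - 'X]opprB dvdpNl dvdp_XsubCl /root.
by rewrite !hornerE subrr.
Qed.

Let DtE n t : (D n).[t] * (lam - t) = (p n).[lam] - (p n).[t].
Proof. by have /(congr1 (horner^~ t)) := DE n; rewrite !hornerE. Qed.

(* [D] is the divided difference of [p]; since the rows of J5 - lam J3 and
   J5 - t J3 kill p(lam) and p(t), applying the former to [D] gives J3 p(t). *)
Let D_row n :
  (if n is m.+2 then (jgamma T m)%:C%C *: D m else 0)
  + (if n is m.+1 then ((jbeta T m)%:C%C - lam * (ja T m)%:C%C) *: D m else 0)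
  + ((jalpha T n)%:C%C - lam * (jb T n)%:C%C) *: D n
  + ((jbeta T n)%:C%C - lam * (ja T n)%:C%C) *: D n.+1
  + (jgamma T n)%:C%C *: D n.+2
  = (if n is m.+1 then (ja T m)%:C%C *: p m else 0)
    + (jb T n)%:C%C *: p n + (ja T n)%:C%C *: p n.+1.
Proof.
have nz : lam%:P - 'X != 0 :> {poly C}.
  by rewrite -opprB oppr_eq0 polyXsubC_eq0.
apply: (mulIf nz); apply: poly_eq_horner => t.
have [_ _ rowp] := pT.
have := rowp lam n; have := rowp t n; rewrite /pencil_row.
have DtE' k : (p k).[lam] = (D k).[t] * (lam - t) + (p k).[t].
  by rewrite DtE subrK.
have sub_eq (a b c d : C) : a = 0 -> b = 0 -> c - d = b - a -> c = d.
  by move=> -> -> /eqP; rewrite subr0 subr_eq0 => /eqP.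
(* With p_k(lam) written as D_k(t) (lam - t) + p_k(t), the row at lam minus the row at t is (lam -
   t) times the difference of the two sides of the claim. *)
case: n => [|[|n]]; rewrite !DtE' => /sub_eq Et /Et; apply;
  by rewrite !hornerE; ring.
Qed.

Let S_D k : second_kind S p k lam = S (D k) 1.
Proof. by []. Qed.

Let S_p k : S (p k) 1 = (k == 0)%:R.
Proof. by have [p0 _ _] := pT; rewrite -p0 ST. Qed.

(** Apply S(., 1) to [D_row]. Since 1 = p_0, orthonormality leaves only column 0 of J3 on the
    right-hand side: b_0, a_0, 0, 0, and so on. *)
Lemma second_kind_pencil_row n :
  pencil_row T lam (fun k => second_kind S p k lam) n =
  match n with
  | 0 => (jb T 0)%:C%C | 1 => (ja T 0)%:C%C | _ => 0
  end.
Proof.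
have /(congr1 (S^~ 1)) := D_row n; rewrite /pencil_row.
case: n => [|[|n]]; rewrite !(linearDl S) !sesquilinearZl ?linear0l !S_p /=;
  move=> DE'; by rewrite !S_D DE' !(mulr0, mulr1, addr0, add0r).
Qed.

Lemma second_kind0 : second_kind S p 0 lam = 0.
Proof.
by have [p0 _ _] := pT; rewrite S_D /D p0 hornerC subrr div0p linear0l.
Qed.

End SecondKind.

Theorem theorem3 (R : realType) (T : jacobi_type_pencil R)
    (S : sesquilinear_functional R) (p u w : nat -> {poly R[i]}) :
  associated_polynomials T p ->
  spectral_function T S ->
  shifted_polynomials T u ->
  double_shifted_polynomials T w ->
  forall lam : R[i],
    @basis_of_subspace R[i] (nat -> R[i]^o) (difference_equation T lam) 4
      [tuple (fun n => (p n).[lam]); (fun n => second_kind S p n lam);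
             (fun n => (u n).[lam]); (fun n => (w n).[lam])].
Proof.
move=> pT ST uT wT lam.
set P := fun n => (p n).[lam]; set Q := fun n => second_kind S p n lam.
set U := fun n => (u n).[lam]; set W := fun n => (w n).[lam].
have rowP n : pencil_row T lam P n = 0 by case: pT => _ _; apply.
have rowQ := second_kind_pencil_row lam pT ST : forall n, pencil_row T lam Q n = _.
have rowU n : pencil_row T lam U n = 0 by exact: shifted_pencil_row.
have rowW n := double_shifted_pencil_row lam n wT : pencil_row T lam W n = _.
have P0 : P 0%N = 1 by case: pT => p0 _ _; rewrite /P p0 hornerC.
have Q0 : Q 0%N = 0 by exact: second_kind0 pT.
have [U0 U1] : U 0%N = 0 /\ U 1%N = 1.
  by case: uT => u0 [u1 _ _]; rewrite /U u0 u1 !hornerC.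
have [W0 W1] : W 0%N = 0 /\ W 1%N = 0.
  by case: wT => w0 w1 _; rewrite /W w0 w1 hornerC.
have combE (c : 'I_4 -> R[i]) n :
    (\sum_(i < 4) c i *: tnth [tuple P; Q; U; W] i : nat -> R[i]^o) n =
    c 0 * P n + c 1 * Q n + c 2%:R * U n + c 3%:R * W n.
  rewrite !big_ord_recr big_ord0 /= add0r !(tnth_nth P) /=.
  by congr (c _ * _ + c _ * _ + c _ * _ + c _ * _); apply: val_inj.
have row_comb a b c d n :
    pencil_row T lam (fun k => a * P k + b * Q k + c * U k + d * W k) n =
    b * pencil_row T lam Q n + d * pencil_row T lam W n.
  by rewrite !pencil_rowD !pencil_rowZ rowP rowU !mulr0 add0r addr0.
split.
- move=> i n n2.
  case: n n2 => [|[|n]] // _.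
  by case: i => [[|[|[|[|?]]]]//] ?; rewrite (tnth_nth P) /= ?rowP ?rowQ ?rowU ?rowW.
- move=> c c0.
  have {}c0 :
      (fun n => c 0 * P n + c 1 * Q n + c 2%:R * U n + c 3%:R * W n) = fun=> 0.
    by apply: funext => n; rewrite -combE c0.
  have row0 n : pencil_row T lam (fun=> 0) n = 0.
    by rewrite /pencil_row; case: n => [|[|n]]; rewrite !mulr0 !addr0.
  (* The system is triangular: row 1 isolates [c 1], then row 0 gives [c 3], the value at 0 gives
     [c 0], and the value at 1 gives [c 2]. *)
  have c1 : c 1 = 0.
    have := row_comb (c 0) (c 1) (c 2%:R) (c 3%:R) 1%N.
    rewrite c0 row0 rowQ rowW mulr0 addr0.
    by move/esym/eqP; rewrite mulf_eq0 (negPf (ja_neq0 _ _)) orbF => /eqP.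
  have c3 : c 3%:R = 0.
    have := row_comb (c 0) (c 1) (c 2%:R) (c 3%:R) 0%N.
    rewrite c0 row0 rowW c1 mul0r add0r.
    by move/esym/eqP; rewrite mulf_eq0 (negPf (jgamma_neq0 _ _)) orbF => /eqP.
  have cz : c 0 = 0.
    have := congr1 (@^~ 0%N) c0.
    by rewrite /= P0 Q0 U0 W0 !mulr0 !addr0 mulr1.
  have c2 : c 2%:R = 0.
    have := congr1 (@^~ 1%N) c0.
    by rewrite /= U1 W1 c1 cz !mul0r !mulr0 mulr1 !add0r addr0.
  case=> [[|[|[|[|//]]]] i4].
  + by rewrite -[RHS]cz; congr c; apply: val_inj.
  + by rewrite -[RHS]c1; congr c; apply: val_inj.
  + by rewrite -[RHS]c2; congr c; apply: val_inj.
  + by rewrite -[RHS]c3; congr c; apply: val_inj.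
- move=> y rowy.
  (* The coefficients solve the same triangular system with the data of [y]: [b] matches row 1, then
     [d] row 0, while [a] and [c] match the values at 0 and 1. *)
  pose a := y 0%N.
  pose b := pencil_row T lam y 1 / (ja T 0)%:C%C.
  pose d := (pencil_row T lam y 0 - b * (jb T 0)%:C%C) / (jgamma T 0)%:C%C.
  pose c := y 1%N - (a * P 1%N + b * Q 1%N).
  exists (fun i => [tuple a; b; c; d]`_i).
  apply: funext => n; rewrite combE /=.
  apply/eqP; rewrite -subr_eq0; apply/eqP.
  move: n; apply: (@pencil_row_eq0 _ T lam).
  + by rewrite P0 Q0 U0 W0 !mulr0 !addr0 mulr1 subrr.
  + by rewrite U1 W1 /c; ring.
  + move=> n.
    have -> : (fun k => y k - (a * P k + b * Q k + c * U k + d * W k)) =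
      fun k => y k + (-1) * (a * P k + b * Q k + c * U k + d * W k).
      by apply: funext => k; rewrite mulN1r.
    rewrite pencil_rowD pencil_rowZ row_comb rowQ rowW.
    (* Rows from 2 on vanish by the difference equation, rows 0 and 1 by the choice of [d] and
       [b]. *)
    case: n => [|[|n]]; last by rewrite rowy // !mulr0 addr0 mulr0 addr0.
      by rewrite /d; field; exact: jgamma_neq0.
    by rewrite /b; field; exact: ja_neq0.
Qed.
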